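(* Let $s$ be a positive integer and let $\Omega_\mu(y_1,\dots,y_s)$ be an identically non-vanishing function of $s$ complex variables $y_1,\dots,y_s$ and of complex order $\mu$. Let $\mu,\psi\in\mathbb{C}$, let $a_l\ne0$ ($l=0,1,2,\dots$) be coefficients, and set $$\Lambda_{\mu,\psi}(y_1,\dots,y_s;\zeta):=\sum_{l=0}^{\infty}a_l\,\Omega_{\mu+\psi l}(y_1,\dots,y_s)\,\zeta^l .$$ For $p\in\mathbb{N}$ and $n\in\mathbb{N}_0$ set $$\Theta_{n,p}^{\mu,\psi}(x_1,\dots,x_r;y_1,\dots,y_s;\xi):=\sum_{l=0}^{[n/p]}a_l\,{}^{(k)}E^{(r)}\left(-(n-pl),\beta_{k+1},\dots,\beta_r;\gamma_1,\dots,\gamma_r;x_1,\dots,x_r\right)\Omega_{\mu+\psi l}(y_1,\dots,y_s)\frac{\xi^l}{(n-pl)!}.$$ Then, for every $p\in\mathbb{N}$, $$\sum_{n=0}^{\infty}\Theta_{n,p}^{\mu,\psi}\left(x_1,\dots,x_r;y_1,\dots,y_s;\frac{\eta}{t^p}\right)t^n=\Lambda_{\mu,\psi}(y_1,\dots,y_s;\eta)\,e^{t}\,{}_0F_1\left(-;\gamma_1;x_1(-t)^{\rho}\right)\cdots{}_0F_1\left(-;\gamma_k;x_k(-t)^{\rho}\right)$$ $$\times\,\Phi\left(\beta_{k+1};\gamma_{k+1};-x_{k+1}t\right)\cdots\Phi\left(\beta_r;\gamma_r;-x_rt\right),$$ provided that each member of this identity exists.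
   Context: $\mathbb{N}=\{1,2,\dots\}$, $\mathbb{N}_0=\mathbb{N}\cup\{0\}$, and $[\cdot]$ is the integer part. The Pochhammer symbol is $(\lambda)_\nu=\Gamma(\lambda+\nu)/\Gamma(\lambda)$ for $\lambda\in\mathbb{C}\setminus\{0,-1,-2,\dots\}$; moreover $(\lambda)_0=1$ and $(\lambda)_n=\lambda(\lambda+1)\cdots(\lambda+n-1)$ for every positive integer $n$ and every $\lambda\in\mathbb{C}$. (In particular, a symbol $(-n)_\nu$ with $n$ a nonnegative integer is defined only for nonnegative integers $\nu$.) Let $r\ge 1$ and $0\le k\le r$ be integers and $\rho\ge 0$. The multivariable hypergeometric function ${}^{(k)}E^{(r)}$ (depending on $\rho$) with complex parameters $\alpha,\beta_{k+1},\dots,\beta_r,\gamma_1,\dots,\gamma_r$ and complex variables $x_1,\dots,x_r$ is $${}^{(k)}E^{(r)}(\alpha,\beta_{k+1},\dots,\beta_r;\gamma_1,\dots,\gamma_r;x_1,\dots,x_r):=\sum_{m_1,\dots,m_r=0}^{\infty}(\alpha)_{\rho(m_1+\dots+m_k)+m_{k+1}+\dots+m_r}\frac{(\beta_{k+1})_{m_{k+1}}\cdots(\beta_r)_{m_r}}{(\gamma_1)_{m_1}\cdots(\gamma_r)_{m_r}}\frac{x_1^{m_1}}{m_1!}\cdots\frac{x_r^{m_r}}{m_r!},$$ where $\rho(\sqrt{|x_1|}+\dots+\sqrt{|x_k|})+|x_{k+1}|+\dots+|x_r|<1$. Here $|t|<1$. Also ${}_0F_1(-;\gamma;z)=\sum_{n=0}^\infty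 \frac{z^n}{(\gamma)_n\,n!}$ and $\Phi(\beta;\gamma;z)={}_1F_1(\beta;\gamma;z)=\sum_{n=0}^\infty\frac{(\beta)_n}{(\gamma)_n}\frac{z^n}{n!}$ is the confluent hypergeometric function. *)

(* Defs.v *)
From HB Require Import structures.
From mathcomp Require Import all_boot all_order all_algebra.
From mathcomp Require Import all_classical all_reals all_analysis.
From mathcomp.analysis.showcase Require summability.
From mathcomp Require Import complex.

Set Implicit Arguments.
Unset Strict Implicit.
Unset Printing Implicit Defensive.

Import Order.TTheory GRing.Theory Num.Theory.
Import numFieldNormedType.Exports.

Local Open Scope ring_scope.
Local Open Scope complex_scope.
Local Open Scope classical_set_scope.

(* The usual topology of the complex plane, given by the modulus. *)
HB.instance Definition _ (R : realType) := NormedModule.copy R[i] R[i]^o.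

Section Special_functions.
Context {R : realType}.
Local Notation C := R[i].

(* (lambda)_n for a natural number n and an arbitrary complex lambda; it
   vanishes when lambda = - N with N a natural number and N < n. *)
Definition pochhammer (lambda : C) (n : nat) : C :=
  \prod_(j < n) (lambda + j%:R).

Definition cexp (z : C) : C := limn (series (fun n => z ^+ n / n`!%:R)).

Definition hyp0F1 (c z : C) : C :=
  limn (series (fun n => z ^+ n / (pochhammer c n * n`!%:R))).

Definition hyp1F1 (b c z : C) : C :=
  limn (series (fun n => pochhammer b n / pochhammer c n * (z ^+ n / n`!%:R))).

Section Multivariable.
Variables (r k rho : nat).

(* Indices are 0-based: the i : 'I_r with i < k are the first k variables.
   Only the values beta i with k <= i are used.  The order rho is a natural
   number: for alpha = - n with n a natural number, the symbol (alpha)_nu is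
   defined for natural nu only. *)

Definition E_term (alpha : C) (beta gamma x : 'I_r -> C)
    (m : {ffun 'I_r -> nat}) : C :=
  pochhammer alpha (rho * (\sum_(i < r | i < k) m i)
                    + \sum_(i < r | k <= i) m i)%N
  * ((\prod_(i < r | (k <= i)%N) pochhammer (beta i) (m i))
     / \prod_(i < r) pochhammer (gamma i) (m i))
  * \prod_(i < r) (x i ^+ m i / (m i)`!%:R).

(* The multiple series is summed unconditionally: the limit is taken over the
   finite sets of multi-indices directed by inclusion. *)
Definition E_fun (alpha : C) (beta gamma x : 'I_r -> C) : C :=
  summability.sum (E_term alpha beta gamma x).

(* The inequality is in the order of R[i], between two real elements. *)
Definition E_domain (x : 'I_r -> C) : Prop :=
  rho%:R * (\sum_(i < r | (i < k)%N) sqrtC `|x i|)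
    + \sum_(i < r | (k <= i)%N) `|x i| < 1.

End Multivariable.

Section Generating_function.
Variables (s : nat) (a : nat -> C) (Omega : C -> ('I_s -> C) -> C).
Variables (mu psi : C).

Definition Lambda_term (y : 'I_s -> C) (zeta : C) (l : nat) : C :=
  a l * Omega (mu + psi * l%:R) y * zeta ^+ l.

Definition Lambda (y : 'I_s -> C) (zeta : C) : C :=
  limn (series (Lambda_term y zeta)).

Definition Theta (r k rho : nat) (beta gamma : 'I_r -> C) (n p : nat)
    (x : 'I_r -> C) (y : 'I_s -> C) (xi : C) : C :=
  \sum_(l < (n %/ p).+1)
    a l * E_fun k rho (- (n - p * l)%:R) beta gamma x
        * Omega (mu + psi * l%:R) y * (xi ^+ l / (n - p * l)`!%:R).

End Generating_function.

End Special_functions.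

(* Main.v *)
Require Import Defs.
From mathcomp Require Import all_boot all_order all_algebra finmap.
From mathcomp Require Import all_classical all_reals all_analysis.
From mathcomp.analysis.showcase Require summability.
From mathcomp Require Import complex ring.

Set Implicit Arguments.
Unset Strict Implicit.
Unset Printing Implicit Defensive.

Import Order.TTheory GRing.Theory Num.Theory.
Import numFieldNormedType.Exports.

Local Open Scope ring_scope.
Local Open Scope complex_scope.
Local Open Scope classical_set_scope.

(** The generating function is a product of three convergent expansions, and
the proof consists of one rearrangement justified by dominated convergence.

Write w(m) for the index of the Pochhammer symbol of alpha at the multi-index
m. Because (-N)_w = (-1)^w N! / (N - w)! when w <= N and 0 otherwise,
  E(-N) t^N / N!  =  sum_m D_m e_(N - w(m)),     e_j = t^j / j!,
where e_j is read as 0 for negative j and D_m is a product over the variables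
of the general terms, of index m_i, of the series 0F1(x_i (-t)^rho) and
1F1(- x_i t): the power (-t)^w(m) is distributed over the variables
[exp_coeff_pochhammer, prod_factor_termE, E_fun_opp_nat]. The series 0F1 and
1F1 are entire, so D is absolutely summable and its sum is the product of
their values [abs_summable_prod, fsum_prod].

Let L_l be the terms of the series Lambda, placed at the indices p l, and P_K
its partial sum over the indices below K. The Theta series is the Cauchy
product of this spaced series with the E(-N) t^N / N!, and its partial sums are
  sum_m D_m W_(J - w(m)),     W_K = sum_(j < K) e_j P_(K - j)
[sum_multiples, sum_convolution, sum_exp_coeff_shift]. The W_K are partial
sums of the Cauchy product of the spaced Lambda series and the exponential
series. The first of these is only assumed to converge, possibly
conditionally, but the second converges absolutely, so W_K tends to
e^t Lambda: this is the theorem of Mertens [mertens_exp]. Being convergent, W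
is bounded, so the limit J -> oo may be taken under the sum over m and gives
e^t Lambda sum_m D_m.

Both limits are instances of Tannery's theorem for absolutely summable
families over an arbitrary index type [tannery]; it rests on the completeness
of the complex plane and on the smallness of the tails of an absolutely
summable family. *)

(* The directed set of finite subsets is a proper filter: this makes the limit
   lemmas apply to unconditional sums. *)
#[local] Existing Instance summability.totally_filter.

(** * Completeness of the complex plane *)

Section Complex_plane.
Context {R : realType}.
Local Notation C := R[i].

Lemma complex_archimedean (z : C) : exists N : nat, `|z| <= N%:R.
Proof.
have /complex_realP[q ->] : `|z| \is Num.real by rewrite realE normr_ge0.
exists (Num.bound `|q|); rewrite -(rmorph_nat (real_complex R)) lecR.
by apply: le_trans (ler_norm q) _; exact/ltW/archi_boundP.
Qed.

Lemma le_norm_Re_Im (z : C) : `|z| <= `|complex.Re z|%:C + `|complex.Im z|%:C.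
Proof.
rewrite {1}(complexE z); apply: (le_trans (ler_normD _ _)).
have normR (q : R) : `|q%:C| = `|q|%:C :> C.
  by rewrite normc_def /= expr0n addr0 sqrtr_sqr.
rewrite normrM !normR.
by rewrite [X in X * _](_ : _ = 1) ?mul1r //
  normc_def /= expr0n expr1n add0r sqrtr1.
Qed.

(** The real and imaginary parts of a Cauchy family are Cauchy families of
real numbers, since both parts are contractions; their limits assemble to the
limit of the family. *)
Lemma complex_cauchy_cvg (T : Type) (F : set_system T) {FF : ProperFilter F}
    (f : T -> C) :
  (forall e : C, 0 < e -> exists c : C, \forall x \near F, `|c - f x| < e) ->
  cvg (f @ F).
Proof.
move=> cauchy_f.
have part (h : C -> R) : (forall z w, `|h z - h w|%:C <= `|z - w|) ->
    cvg ((h \o f) @ F).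
  move=> h_contr; apply/cauchy_cvgP/cauchy_exP => e e0.
  have e0C : 0 < e%:C by rewrite ltcR.
  have [c near_c] := cauchy_f _ e0C; exists (h c).
  apply: filterS near_c => x /=; rewrite -ball_normE /=.
  move=> /(le_lt_trans _) lt_e.
  by rewrite -ltcR; apply: lt_e.
have /cvg_ex[u cvg_u] : cvg ((@complex.Re R \o f) @ F).
  by apply: part => -[a b] [c d]; exact: (normc_ge_Re ((a - c) +i* (b - d))).
have /cvg_ex[v cvg_v] : cvg ((@complex.Im R \o f) @ F).
  apply: part => -[a b] [c d].
  have := normc_ge_Re (((a - c) +i* (b - d)) * 'i); rewrite ReiNIm normrN.
  by rewrite normrM [X in _ * X](_ : _ = 1) ?mulr1 //
    normc_def /= expr0n expr1n add0r sqrtr1.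
apply/cvg_ex; exists (u +i* v); apply/cvgrPdist_lt => e e0.
have e_re : e = (complex.Re e)%:C by rewrite RRe_real // gtr0_real.
have h0 : 0 < complex.Re e / 2 by rewrite divr_gt0 // -ltcR -e_re.
have /cvgrPdist_lt/(_ _ h0) near_u := cvg_u.
have /cvgrPdist_lt/(_ _ h0) near_v := cvg_v.
apply: filterS2 near_u near_v => x /= lt_u lt_v.
apply: (le_lt_trans (le_norm_Re_Im _)).
rewrite e_re (splitr (complex.Re e)) rmorphD /=.
by apply: ltrD; rewrite ltcR; case: (f x) lt_u lt_v.
Qed.

End Complex_plane.

(** * Absolutely summable families *)

Section Summable_families.
Context {R : realType}.
Local Notation C := R[i].

Definition abs_summable (I : choiceType) (d : I -> C) :=
  exists B : C, forall A : {fset I}, \sum_(i <- A) `|d i| <= B.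

Lemma fsum_le_incl (I : choiceType) (d : I -> C) (A B : {fset I}) :
  (A `<=` B)%fset -> \sum_(i <- A) `|d i| <= \sum_(i <- B) `|d i|.
Proof.
move=> AB; rewrite [leRHS](big_fsetID _ (mem A)) /=.
rewrite [X in _ <= X + _](_ : _ = \sum_(i <- A) `|d i|).
  by rewrite lerDl sumr_ge0.
apply: eq_fbigl => i; rewrite !inE; apply/andP/idP => [[]//|iA]; split => //.
exact: (fsubsetP AB).
Qed.

(** A finite set on which the sum of the moduli comes within e of its supremum
leaves less than e to every finite set disjoint from it. *)
Lemma abs_summable_tail (I : choiceType) (d : I -> C) (e : C) :
  abs_summable d -> 0 < e ->
  exists A : {fset I}, forall J : {fset I},
    (forall i, i \in J -> i \notin A) -> \sum_(i <- J) `|d i| < e.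
Proof.
move=> [B dB] e0.
pose N (A : {fset I}) : R := complex.Re (\sum_(i <- A) `|d i|).
have NE (A : {fset I}) : \sum_(i <- A) `|d i| = (N A)%:C.
  by rewrite RRe_real // ger0_real // sumr_ge0.
have e_re : e = (complex.Re e)%:C by rewrite RRe_real // gtr0_real.
have e0R : 0 < complex.Re e by rewrite -ltcR -e_re.
have N_sup : has_sup (range N).
  split; first by exists (N fset0); exists fset0.
  exists (complex.Re B) => _ [A _ <-].
  by have := dB A; rewrite lecE => /andP[_].
have [_ [A _ <-] ltA] := sup_adherent e0R N_sup.
exists A => J JA.
have : N (A `|` J)%fset <= sup (range N).
  by apply: ub_le_sup; [exact: N_sup.2|exists (A `|` J)%fset].
have -> : N (A `|` J)%fset = N A + N J.
  apply: complexI; rewrite rmorphD /= -!NE (big_fsetID _ (mem A)) /=.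
  congr (_ + _); apply: eq_fbigl => i; rewrite !inE.
    by case: (i \in A); rewrite ?andbF.
  by case: (boolP (i \in A)) => //= iA; rewrite ?andbT ?andbF //;
    apply/esym/negP => /JA; rewrite iA.
rewrite NE e_re ltcR.
move: ltA; rewrite ltrBlDr => lt1 le2.
by rewrite -(ltrD2l (N A)); apply: le_lt_trans le2 lt1.
Qed.

(** By smallness of the tails the finite partial sums form a Cauchy family. *)
Lemma fsum_cvg (I : choiceType) (d : I -> C) :
  abs_summable d ->
  (fun A : {fset I} => \sum_(i <- A) d i) @ summability.totally
    --> summability.sum d.
Proof.
move=> dS.
have partialE : summability.partial_sum d =
    (fun A : {fset I} => \sum_(i <- A) d i).
  by apply/funext => A; rewrite /summability.partial_sum big_seq_fsetE.
rewrite /summability.sum partialE.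
apply: complex_cauchy_cvg => e e0.
have [A tailA] := abs_summable_tail dS e0.
exists (\sum_(i <- A) d i); exists A => // J /= AJ.
rewrite [\sum_(i <- J) _](big_fsetID _ (mem A)) /=.
rewrite [X in _ - (X + _)](_ : _ = \sum_(i <- A) d i); last first.
  apply: eq_fbigl => i; rewrite !inE; apply/andP/idP => [[]//|iA]; split => //.
  exact: (fsubsetP AJ).
rewrite opprD addrA subrr add0r normrN.
apply: (le_lt_trans (ler_norm_sum _ _ _)); apply: tailA => i.
by rewrite !inE => /andP[].
Qed.

Lemma fsum_unique (I : choiceType) (d : I -> C) (l : C) :
  (fun A : {fset I} => \sum_(i <- A) d i) @ summability.totally --> l ->
  summability.sum d = l.
Proof.
move=> dl; rewrite /summability.sum.
have -> : summability.partial_sum d = (fun A : {fset I} => \sum_(i <- A) d i).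
  by apply/funext => A; rewrite /summability.partial_sum big_seq_fsetE.
by apply: cvg_lim dl; exact: norm_hausdorff.
Qed.

(** The unconditional sum can be computed along any sequence of finite sets that
absorbs every index; boxes are used for multi-indices and initial segments for
natural numbers. *)
Lemma fsum_exhaust (I : choiceType) (d : I -> C) (S : nat -> {fset I}) :
  abs_summable d ->
  (forall i, \forall n \near \oo, i \in S n) ->
  (fun n => \sum_(i <- S n) d i) @ \oo --> summability.sum d.
Proof.
move=> dS exhS; apply: (cvg_comp S _ _ (fsum_cvg dS)) => P [A _ AP].
suff : \forall n \near \oo, (A `<=` S n)%fset by apply: filterS => n /AP.
have : forall s : seq I, \forall n \near \oo, {subset s <= S n}.
  elim=> [|i s IHs]; first by near=> n => i.
  apply: filterS2 (exhS i) IHs => n iS sS j.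
  by rewrite inE => /predU1P[-> //|/sS].
by move=> /(_ A); apply: filterS => n AS; apply/fsubsetP.
Unshelve. all: by end_near. Qed.

Lemma abs_summableM (I : choiceType) (d w : I -> C) (B : C) :
  abs_summable d -> (forall i, `|w i| <= B) ->
  abs_summable (fun i => d i * w i).
Proof.
move=> [D dD] wB; exists (D * `|B|) => A.
apply: (@le_trans _ _ ((\sum_(i <- A) `|d i|) * `|B|)); last first.
  by rewrite ler_wpM2r.
rewrite mulr_suml; apply: ler_sum => i _; rewrite normrM ler_wpM2l //.
apply: le_trans (wB i) _; rewrite ger0_norm //; exact: le_trans (wB i).
Qed.

Lemma fsum_linear (I : choiceType) (J : Type) (s : seq J) (c : J -> C)
    (f : J -> I -> C) :
  (forall j, abs_summable (f j)) ->
  \sum_(j <- s) c j * summability.sum (f j)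
  = summability.sum (fun i => \sum_(j <- s) c j * f j i).
Proof.
move=> fS; apply/esym/fsum_unique.
have -> : (fun A : {fset I} => \sum_(i <- A) \sum_(j <- s) c j * f j i)
    = (fun A : {fset I} => \sum_(j <- s) c j * \sum_(i <- A) f j i).
  apply/funext => A; rewrite exchange_big; apply: eq_bigr => j _.
  by rewrite mulr_sumr.
by apply: (cvg_big add_continuous) => j _; apply: cvgMl_tmp; exact: fsum_cvg.
Qed.

Lemma fsumZr (I : choiceType) (d : I -> C) (c : C) :
  abs_summable d ->
  summability.sum (fun i => d i * c) = summability.sum d * c.
Proof.
move=> dS; have := @fsum_linear I unit [:: tt] (fun=> c) (fun=> d) (fun=> dS).
rewrite big_seq1 mulrC => ->; congr summability.sum; apply/funext => i.
by rewrite big_seq1 mulrC.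
Qed.

Lemma fsumB (I : choiceType) (f g : I -> C) :
  abs_summable f -> abs_summable g ->
  summability.sum (fun i => f i - g i) = summability.sum f - summability.sum g.
Proof.
move=> fS gS; apply: fsum_unique; under eq_fun do rewrite sumrB.
by apply: cvgB; exact: fsum_cvg.
Qed.

Lemma norm_lim_le (K : numFieldType) (V : normedModType K) (T : Type)
    (F : set_system T) {FF : ProperFilter F} (f : T -> V) (l : V) (B : K) :
  f @ F --> l -> (forall x, `|f x| <= B) -> `|l| <= B.
Proof.
move=> fl fB; apply/ler_addgt0Pr => e e0.
have /cvgrPdist_lt/(_ _ e0)/filter_ex[x lx] := fl.
rewrite -(subrK (f x) l) addrC; apply: (le_trans (ler_normD _ _)).
by rewrite lerD // ltW.
Qed.

Lemma norm_fsum_le (I : choiceType) (d : I -> C) (B : C) :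
  (forall A : {fset I}, \sum_(i <- A) `|d i| <= B) -> `|summability.sum d| <= B.
Proof.
move=> dB; have dS : abs_summable d by exists B.
apply: (norm_lim_le (fsum_cvg dS)).
by move=> A; exact: le_trans (ler_norm_sum _ _ _) (dB A).
Qed.

(** Dominated convergence for families: the finitely many indices that carry
almost all of the mass of d converge together, and the others contribute at
most the bound on v - u times a small tail of d. *)
Lemma tannery (I : choiceType) (d : I -> C) (u : nat -> I -> C) (v : I -> C)
    (B : C) :
  abs_summable d -> (forall n i, `|u n i| <= B) ->
  (forall i, (fun n => u n i) @ \oo --> v i) ->
  (fun n => summability.sum (fun i => d i * u n i)) @ \oo
    --> summability.sum (fun i => d i * v i).
Proof.
move=> dS uB uv.
have vB i : `|v i| <= B by apply: norm_lim_le (uv i) _.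
have uS n : abs_summable (fun i => d i * u n i) by apply: abs_summableM (uB n).
have vS : abs_summable (fun i => d i * v i) by apply: abs_summableM vB.
pose M : C := 1 + (`|B| + `|B|).
have M0 : 0 < M by rewrite ltr_wpDr // addr_ge0.
have uvM n i : `|v i - u n i| <= M.
  apply: (le_trans (ler_normB _ _)); apply: ler_wpDl => //.
  by apply: lerD; [apply: le_trans (vB i) _|apply: le_trans (uB n i) _];
     rewrite ger0_norm //; exact: le_trans (vB i).
apply/cvgrPdist_le => e e0.
have [A tailA] := abs_summable_tail dS (divr_gt0 (divr_gt0 e0 (ltr0Sn C 1)) M0).
have : (fun n => \sum_(i <- A) `|d i| * `|v i - u n i|) @ \oo --> (0 : C).
  rewrite [X in _ --> X](_ : _ = \sum_(i <- A) (0 : C)); last by rewrite big1.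
  apply: (cvg_big add_continuous) => i _;
  rewrite -[0](mulr0 `|d i|); apply: cvgMl_tmp.
  rewrite -[0](@normr0 _ C) -(subrr (v i)); apply: cvg_norm.
  by apply: cvgB; [exact: cvg_cst|exact: uv].
move=> /cvgrPdist_lt/(_ (e / 2) (divr_gt0 e0 (ltr0Sn C 1))).
apply: filterS => n; rewrite sub0r normrN ger0_norm ?sumr_ge0// => headA.
have -> : summability.sum (fun i => d i * v i)
    - summability.sum (fun i => d i * u n i)
    = summability.sum (fun i => d i * (v i - u n i)).
  under [in RHS]eq_fun do rewrite mulrBr.
  by rewrite fsumB.
apply: norm_fsum_le => J.
rewrite (big_fsetID _ (mem A)) /= [e]splitr; apply: lerD.
  apply: le_trans (ltW headA).
  under [leRHS]eq_bigr do rewrite -normrM.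
  apply: fsum_le_incl; apply/fsubsetP => i.
  by rewrite !inE => /andP[].
apply: (@le_trans _ _ (\sum_(i <- [fset x in J | x \notin A]%fset) `|d i| * M)).
  by apply: ler_sum => i _; rewrite normrM ler_wpM2l.
rewrite -mulr_suml -ler_pdivlMr //; apply/ltW/tailA => i.
by rewrite !inE => /andP[].
Qed.

(** * Series and products of series as sums of families *)

Definition initial_segment (n : nat) : {fset nat} :=
  [fset val i | i in 'I_n]%fset.

Lemma in_initial_segment n i : (i \in initial_segment n) = (i < n)%N.
Proof.
apply/imfsetP/idP => [[j _ ->]|i_n]; first exact: ltn_ord.
by exists (Ordinal i_n).
Qed.

Lemma sum_initial_segment (V : nmodType) (F : nat -> V) n :
  \sum_(i <- initial_segment n) F i = \sum_(i < n) F i.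
Proof.
rewrite big_imfset /=; last by move=> i j _ _; exact: val_inj.
by rewrite big_enum.
Qed.

Lemma fsum_nat (d : nat -> C) :
  abs_summable d -> series d @ \oo --> summability.sum d.
Proof.
move=> dS.
have -> : series d = (fun n => \sum_(i <- initial_segment n) d i).
  by apply/funext => n; rewrite sum_initial_segment seriesEord.
apply: fsum_exhaust => // i; exists i.+1 => // n /=.
by rewrite in_initial_segment.
Qed.

Lemma abs_summable_nat (d : nat -> C) (B : C) :
  (forall n, \sum_(j < n) `|d j| <= B) -> abs_summable d.
Proof.
move=> dB; exists B => A.
pose n := (\max_(i <- A) i).+1.
apply: le_trans (dB n); rewrite -(sum_initial_segment (fun i => `|d i|)).
apply: fsum_le_incl; apply/fsubsetP => i iA.
by rewrite in_initial_segment ltnS (leq_bigmax_seq (F := id)).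
Qed.

(** Along a ratio at most 1/2, adding twice the modulus of the next term to the
sum of the moduli gives a nonincreasing quantity. *)
Lemma abs_summable_ratio (d : nat -> C) (N : nat) :
  (forall n, (N <= n)%N -> `|d n.+1| * 2 <= `|d n|) -> abs_summable d.
Proof.
move=> ratio.
pose S n : C := \sum_(j < n) `|d j|.
have tailN j : S (N + j)%N + `|d (N + j)%N| * 2 <= S N + `|d N| * 2.
  elim: j => [|j IHj]; first by rewrite addn0.
  apply: le_trans IHj; rewrite addnS /S big_ord_recr /= -addrA lerD2l.
  by rewrite [leRHS]mulr_natr mulr2n lerD2l ratio // leq_addr.
apply: (@abs_summable_nat _ (S N + `|d N| * 2)) => n.
apply: (@le_trans _ _ (S (N + n)%N)).
  rewrite /S addnC big_split_ord /= lerDl; exact: sumr_ge0.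
by apply: le_trans (tailN n); rewrite lerDl mulr_ge0.
Qed.

(** Ratios of order 1 / n: the common form of the exponential, 0F1 and 1F1
series, which have infinite radius of convergence. *)
Lemma abs_summable_entire (d : nat -> C) (M : C) (N : nat) :
  0 <= M ->
  (forall n, (N <= n)%N -> `|d n.+1| * n.+1%:R <= M * `|d n|) -> abs_summable d.
Proof.
move=> M0 dM; have [K MK] := complex_archimedean M.
rewrite ger0_norm // in MK.
apply: (@abs_summable_ratio _ (maxn N (K * 2))) => n.
rewrite geq_max => /andP[Nn Kn].
rewrite -(ler_pM2r (ltr0Sn C n)) mulrAC.
apply: (@le_trans _ _ (K%:R * `|d n| * 2)).
  by rewrite ler_wpM2r // (le_trans (dM n Nn)) // ler_wpM2r.
by rewrite mulrAC mulrC ler_wpM2l // -natrM ler_nat ltnW // ltnS.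
Qed.

Definition ffun_val (I : finType) (n : nat) (g : {ffun I -> 'I_n}) :
  {ffun I -> nat} := [ffun i => val (g i)].

Definition box (I : finType) (n : nat) : {fset {ffun I -> nat}} :=
  [fset ffun_val g | g in {ffun I -> 'I_n}]%fset.

Lemma in_box (I : finType) n (m : {ffun I -> nat}) :
  (m \in box I n) = [forall i, m i < n]%N.
Proof.
apply/imfsetP/forallP => [[g _ ->] i|mn]; first by rewrite ffunE ltn_ord.
exists [ffun i => Ordinal (mn i)] => //.
by apply/ffunP => i; rewrite !ffunE.
Qed.

Lemma sum_box (I : finType) (V : comNzRingType) (f : I -> nat -> V) (n : nat) :
  \sum_(m <- box I n) \prod_i f i (m i) = \prod_i \sum_(j < n) f i j.
Proof.
rewrite bigA_distr_bigA /= big_imfset /=; last first.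
  move=> g h _ _ /ffunP gh; apply/ffunP => i.
  by have := gh i; rewrite !ffunE => /val_inj.
rewrite big_enum /=; apply: eq_bigr => g _; apply: eq_bigr => i _.
by rewrite ffunE.
Qed.

(** Every finite set of multi-indices lies in a box, over which the sum of the
moduli of the products is the product of the partial sums. *)
Lemma abs_summable_prod (I : finType) (f : I -> nat -> C) :
  (forall i, abs_summable (f i)) ->
  abs_summable (fun m : {ffun I -> nat} => \prod_i f i (m i)).
Proof.
move=> /choice[B fB]; exists (\prod_i B i) => A.
have [n An] : exists n, (A `<=` box I n)%fset.
  exists (\max_(m <- A) \max_i m i).+1; apply/fsubsetP => m mA.
  rewrite in_box; apply/forallP => i; rewrite ltnS.
  apply: (@leq_trans (\max_j m j)); first exact: (leq_bigmax (F := m)).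
  exact: (leq_bigmax_seq (F := fun m : {ffun I -> nat} => \max_j m j) _ mA).
apply: le_trans (fsum_le_incl _ An) _.
under [leLHS]eq_bigr do rewrite normr_prod.
rewrite (sum_box (fun i j => `|f i j|)); apply: ler_prod => i _.
rewrite sumr_ge0 //=; apply: le_trans (fB i (initial_segment n)).
by rewrite sum_initial_segment.
Qed.

(** On boxes this is the distributivity of a finite product over finite sums. *)
Lemma fsum_prod (I : finType) (f : I -> nat -> C) :
  (forall i, abs_summable (f i)) ->
  summability.sum (fun m : {ffun I -> nat} => \prod_i f i (m i))
  = \prod_i summability.sum (f i).
Proof.
move=> fS.
have /(fsum_exhaust (abs_summable_prod fS)) : forall m : {ffun I -> nat},
    \forall n \near \oo, m \in box I n.
  move=> m; exists (\max_i m i).+1 => // n /= mn.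
  rewrite in_box; apply/forallP => i; apply: leq_trans mn; rewrite ltnS.
  exact: (leq_bigmax (F := m)).
have -> : (fun n => \sum_(m <- box I n) \prod_i f i (m i))
    = (fun n => \prod_i \sum_(j < n) f i j).
  by apply/funext => n; exact: sum_box.
move=> box_cvg; apply/esym; move: box_cvg.
apply: cvg_unique; first exact: norm_hausdorff.
apply: (cvg_big mul_continuous) => i _; have := fsum_nat (fS i).
by rewrite seriesEord.
Qed.

Lemma abs_summable_bounded (I : choiceType) (d : I -> C) :
  abs_summable d -> exists B : C, forall i, `|d i| <= B.
Proof.
by move=> [B dB]; exists B => i; have := dB [fset i]%fset;
  rewrite big_seq_fset1.
Qed.

Lemma limn_fsum (d : nat -> C) :
  abs_summable d -> limn (series d) = summability.sum d.
Proof.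
by move=> dS; apply: cvg_lim (fsum_nat dS); exact: norm_hausdorff.
Qed.

Lemma fsum_finite_support (d : nat -> C) (K : nat) :
  (forall j, (K <= j)%N -> d j = 0) ->
  summability.sum d = \sum_(j < K) d j.
Proof.
move=> d0; apply: fsum_unique; apply: cvg_near_cst.
exists (initial_segment K) => // A /= KA.
rewrite -(sum_initial_segment d); apply/esym; apply: big_fset_incl => // j _.
by rewrite in_initial_segment -leqNgt => /d0.
Qed.

Lemma cvg_bounded (K : numFieldType) (V : normedModType K) (u : nat -> V)
    (l : V) :
  u @ \oo --> l -> exists B : K, forall n, `|u n| <= B.
Proof.
move=> ul; have /cvg_seq_bounded/pinfty_ex_gt0[B _ uB] : cvgn u.
  by apply/cvg_ex; exists l.
by exists B => n; exact: uB.
Qed.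

(** The function h' is an explicit rate at which h tends to infinity. *)
Lemma cvg_infty_comp (T : topologicalType) (u : nat -> T) (l : T)
    (h h' : nat -> nat) :
  (forall N n, (h' N <= n)%N -> (N <= h n)%N) ->
  u @ \oo --> l -> (fun n => u (h n)) @ \oo --> l.
Proof.
move=> hh ul P /ul[N _ NP].
by exists (h' N) => // n /= /hh /NP.
Qed.

End Summable_families.

(** * The exponential and confluent hypergeometric series *)

Section Hypergeometric_series.
Context {R : realType}.
Local Notation C := R[i].

Lemma pochhammerS (c : C) n : pochhammer c n.+1 = pochhammer c n * (c + n%:R).
Proof. by rewrite /pochhammer big_ord_recr. Qed.

Lemma pochhammer_opp_nat (n m : nat) :
  pochhammer (- n%:R : C) m = (-1) ^+ m * (n ^_ m)%:R.
Proof.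
elim: m => [|m IHm]; first by rewrite /pochhammer big_ord0 expr0 ffactn0 mulr1.
rewrite pochhammerS IHm ffactnSr natrM.
have [mn|nm] := leqP m n; last first.
  by rewrite ffact_small // !(mulr0n, mulr0, mul0r).
by rewrite natrB // exprS; ring.
Qed.

(** Keeps the factors c + n in the denominators of the term ratios away from 0
for large n. *)
Lemma shift_norm_ge1 (c : C) :
  exists N, forall n, (N <= n)%N -> 1 <= `|c + n%:R|.
Proof.
have [K cK] := complex_archimedean c; exists K.+1 => n Kn.
have -> : c + n%:R = n%:R - (- c) by rewrite opprK addrC.
apply: le_trans (lerB_dist _ _); rewrite normrN normr_nat lerBrDr.
by apply: (@le_trans _ _ (1 + K%:R)); rewrite ?lerD2l // nat1r ler_nat.
Qed.

Lemma abs_summable_exp (z : C) : abs_summable (fun n => z ^+ n / n`!%:R).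
Proof.
apply: (@abs_summable_entire _ _ `|z| 0) => // n _.
have -> : z ^+ n.+1 / n.+1`!%:R = z * (z ^+ n / n`!%:R) / n.+1%:R.
  by rewrite exprS factS natrM invfM; ring.
by rewrite normrM normfV normr_nat mulfVK ?pnatr_eq0 // normrM.
Qed.

Lemma abs_summable_0F1 (c z : C) :
  abs_summable (fun n => z ^+ n / (pochhammer c n * n`!%:R)).
Proof.
have [N cN] := shift_norm_ge1 c.
apply: (@abs_summable_entire _ _ `|z| N) => // n /cN c1.
have -> : z ^+ n.+1 / (pochhammer c n.+1 * n.+1`!%:R) =
    z * (z ^+ n / (pochhammer c n * n`!%:R)) / (c + n%:R) / n.+1%:R.
  by rewrite exprS factS natrM pochhammerS !invfM; ring.
rewrite normrM normfV normr_nat mulfVK ?pnatr_eq0 //.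
rewrite normrM normfV [X in X / _]normrM.
by rewrite ler_piMr ?mulr_ge0 // invf_le1 // (lt_le_trans ltr01).
Qed.

Lemma abs_summable_1F1 (b c z : C) :
  abs_summable (fun n => pochhammer b n / pochhammer c n * (z ^+ n / n`!%:R)).
Proof.
have [N cN] := shift_norm_ge1 c.
apply: (@abs_summable_entire _ _ ((1 + `|b - c|) * `|z|) N) => [|n /cN c1].
  by rewrite mulr_ge0 // addr_ge0.
have cn0 : c + n%:R != 0 by rewrite -normr_gt0 (lt_le_trans ltr01).
have -> : pochhammer b n.+1 / pochhammer c n.+1 * (z ^+ n.+1 / n.+1`!%:R) =
    (b + n%:R) / (c + n%:R) * z
    * (pochhammer b n / pochhammer c n * (z ^+ n / n`!%:R)) / n.+1%:R.
  by rewrite exprS factS natrM !pochhammerS !invfM; ring.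
rewrite [X in X * _]normrM normfV normr_nat mulfVK ?pnatr_eq0 //.
rewrite normrM ler_wpM2r // normrM ler_wpM2r //.
have -> : (b + n%:R) / (c + n%:R) = 1 + (b - c) / (c + n%:R) by field.
apply: (le_trans (ler_normD _ _)); rewrite normr1 lerD2l normrM normfV.
by rewrite ler_piMr // invf_le1 // (lt_le_trans ltr01).
Qed.

End Hypergeometric_series.

(** * Rearrangement of partial sums *)

(** Spacing the coefficients L by p with zeros turns the sum over l <= n / p
into a Cauchy product with h. *)
Lemma sum_multiples (V : pzSemiRingType) (L h : nat -> V) (p n : nat) :
  (0 < p)%N ->
  \sum_(q < n.+1) (if (p %| q)%N then L (q %/ p)%N else 0) * h (n - q)%N
  = \sum_(l < (n %/ p).+1) L l * h (n - p * l)%N.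
Proof.
move=> p0.
rewrite (bigID (fun q : 'I_n.+1 => (p %| q)%N)) /= [X in _ + X]big1 ?addr0;
    last first.
  by move=> q /negPf ->; rewrite mul0r.
have mulP (l : 'I_(n %/ p).+1) : (p * l < n.+1)%N.
  by rewrite ltnS mulnC -leq_divRL //; exact: (ltn_ord l).
have divP (q : 'I_n.+1) : (q %/ p < (n %/ p).+1)%N.
  by rewrite ltnS leq_div2r //; exact: (ltn_ord q).
rewrite (reindex_onto (fun l => Ordinal (mulP l))
  (fun q => Ordinal (divP q))) /=.
  apply: eq_big => l; first apply/esym.
    by rewrite -val_eqE /= mulKn // eqxx andbT dvdn_mulr.
  by move=> _; rewrite dvdn_mulr // mulKn.
by move=> q pq; apply/val_inj; rewrite /= mulnC divnK.
Qed.

Lemma sum_convolution (V : comPzSemiRingType) (lam g : nat -> V) (J : nat) :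
  \sum_(n < J) \sum_(q < n.+1) lam q * g (n - q)%N
  = \sum_(N < J) g N * \sum_(q < (J - N)%N) lam q.
Proof.
elim: J => [|J IHJ]; first by rewrite !big_ord0.
rewrite big_ord_recr IHJ /=.
have -> : \sum_(N < J.+1) g N * \sum_(q < (J.+1 - N)%N) lam q
    = \sum_(N < J.+1) (g N * \sum_(q < (J - N)%N) lam q + g N * lam (J - N)%N).
  apply: eq_bigr => N _; rewrite subSn; last exact: (ltn_ord N).
  by rewrite big_ord_recr mulrDr.
rewrite big_split /= [X in _ = X + _]big_ord_recr /= subnn big_ord0 mulr0 addr0.
congr (_ + _); rewrite (reindex_inj rev_ord_inj) /=; apply: eq_bigr => i _.
by rewrite subSS subKn 1?mulrC //; exact: (ltn_ord i).
Qed.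

Section Generating_function.
Context {R : realType}.
Local Notation C := R[i].

(** The coefficient t^(N - M) / (N - M)! of the exponential series, with the
convention 1 / (negative integer)! = 0 that keeps the truncated subtraction
from producing spurious terms. *)
Definition exp_coeff_shift (t : C) (M N : nat) : C :=
  if (M <= N)%N then t ^+ (N - M) / (N - M)`!%:R else 0.

(** The factor N! of (-N)_M = (-1)^M N! / (N - M)! cancels the denominator of
t^N / N!, and M of the powers of t go with the sign. *)
Lemma exp_coeff_pochhammer (t : C) (M N : nat) :
  t ^+ N / N`!%:R * pochhammer (- N%:R) M = (- t) ^+ M * exp_coeff_shift t M N.
Proof.
rewrite pochhammer_opp_nat /exp_coeff_shift.
have [MN|NM] := leqP M N; last by rewrite ffact_small // !mulr0.
have fact0 n : n`!%:R != 0 :> C by rewrite pnatr_eq0 -lt0n fact_gt0.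
rewrite -(ffact_fact MN) -{1}(subnKC MN) exprD (exprNn t M) natrM.
have : (N ^_ M)%:R != 0 :> C by rewrite pnatr_eq0 -lt0n ffact_gt0.
by move=> ff0; field; rewrite ff0 fact0.
Qed.

Lemma exp_coeff_shift_bounded (t : C) :
  exists B : C, forall M N, `|exp_coeff_shift t M N| <= B.
Proof.
have [B tB] := abs_summable_bounded (abs_summable_exp t); exists B => M N.
by rewrite /exp_coeff_shift; case: leqP => // _; rewrite normr0;
  exact: le_trans (tB 0%N).
Qed.

(** * The function E at nonpositive integers *)

Section Reduction.
Variables (r k rho : nat) (beta gamma x : 'I_r -> C) (t : C).

Definition pochhammer_index (m : {ffun 'I_r -> nat}) : nat :=
  (rho * (\sum_(i < r | i < k) m i) + \sum_(i < r | k <= i) m i)%N.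

(** The general term of the series of the i-th factor on the right-hand side of
the generating function. *)
Definition factor_term (i : 'I_r) (j : nat) : C :=
  if (i < k)%N
  then (x i * (- t) ^+ rho) ^+ j / (pochhammer (gamma i) j * j`!%:R)
  else pochhammer (beta i) j / pochhammer (gamma i) j
       * ((- (x i * t)) ^+ j / j`!%:R).

Lemma factor_term_summable i : abs_summable (factor_term i).
Proof.
rewrite /factor_term; case: (i < k)%N;
  [exact: abs_summable_0F1|exact: abs_summable_1F1].
Qed.

(** Each m_i contributes rho m_i or m_i to the index, hence exactly the power
of -t that its own series absorbs. *)
Lemma prod_factor_termE (m : {ffun 'I_r -> nat}) :
  \prod_i factor_term i (m i) =
  (- t) ^+ pochhammer_index m
  * ((\prod_(i < r | (k <= i)%N) pochhammer (beta i) (m i))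
     / \prod_(i < r) pochhammer (gamma i) (m i))
  * \prod_(i < r) (x i ^+ m i / (m i)`!%:R).
Proof.
have -> : pochhammer_index m =
    (\sum_(i < r) (if i < k then rho * m i else m i))%N.
  rewrite /pochhammer_index big_distrr /=
    [in RHS](bigID (fun i : 'I_r => i < k)%N) /=.
  congr (_ + _)%N; first by apply: eq_bigr => i ->.
  apply: eq_big => i; first by rewrite (leqNgt k i).
  by rewrite (leqNgt k i) => /negPf ->.
rewrite -prodrXr [X in _ * (X / _)]big_mkcond -prodfV -!big_split /=.
apply: eq_bigr => i _; rewrite /factor_term (leqNgt k i); case: (i < k)%N => /=.
  by rewrite exprMn exprM mul1r invfM; ring.
by rewrite -mulrN exprMn; ring.
Qed.

Lemma E_fun_opp_nat (N : nat) :
  t != 0 ->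
  t ^+ N / N`!%:R * E_fun k rho (- N%:R) beta gamma x =
  summability.sum (fun m : {ffun 'I_r -> nat} =>
    (\prod_i factor_term i (m i)) * exp_coeff_shift t (pochhammer_index m) N).
Proof.
move=> t0; have fact0 : N`!%:R != 0 :> C by rewrite pnatr_eq0 -lt0n fact_gt0.
have c0 : t ^+ N / N`!%:R != 0 by rewrite mulf_neq0 ?invr_eq0 ?expf_neq0.
have [B tB] := exp_coeff_shift_bounded t.
rewrite /E_fun.
have -> : E_term k rho (- N%:R) beta gamma x =
    (fun m => (\prod_i factor_term i (m i))
              * exp_coeff_shift t (pochhammer_index m) N
              * (t ^+ N / N`!%:R)^-1).
  apply/funext => m; apply: (mulIf c0); rewrite mulfVK //.
  have regroup (P c A e q w : C)  :
      c * P = A * e -> P * q * w * c = A * q * w * e.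
    move=> cP; transitivity (c * P * (q * w)); first by ring.
    by rewrite cP; ring.
  by rewrite prod_factor_termE; apply: regroup; exact: exp_coeff_pochhammer.
rewrite fsumZr; first by rewrite mulrC mulfVK.
by apply: abs_summableM (abs_summable_prod factor_term_summable) _ => m;
  exact: tB.
Qed.

End Reduction.

(** * Limits of the partial sums *)

Lemma sum_exp_coeff_shift (t : C) (P : nat -> C) (M J : nat) :
  \sum_(N < J) exp_coeff_shift t M N * P (J - N)%N
  = \sum_(j < (J - M)%N) t ^+ j / j`!%:R * P (J - M - j)%N.
Proof.
have [JM|/ltnW MJ] := leqP J M.
  rewrite (eqP JM) big_ord0 big1 // => N _.
  by rewrite /exp_coeff_shift leqNgt (leq_trans (ltn_ord N)) // mul0r.
rewrite -(subnKC MJ); move: (J - M)%N => K {J MJ}.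
rewrite big_split_ord /= big1 ?add0r => [|N _]; last first.
  by rewrite /exp_coeff_shift leqNgt ltn_ord mul0r.
rewrite !addKn; apply: eq_bigr => j _.
by rewrite /exp_coeff_shift leq_addr addKn subnDl.
Qed.

(** Mertens' theorem for the exponential series. The hypothesis on P 0 makes
the truncated difference K - j harmless: the terms with j >= K vanish, so each
partial sum is a sum over all j, to which dominated convergence applies. *)
Lemma mertens_exp (t : C) (P : nat -> C) (l : C) :
  P 0%N = 0 -> P @ \oo --> l ->
  (fun K => \sum_(j < K) t ^+ j / j`!%:R * P (K - j)%N) @ \oo --> cexp t * l.
Proof.
move=> P0 Pl; have tS := abs_summable_exp t.
have [B PB] := cvg_bounded Pl.
rewrite /cexp (limn_fsum tS) -(fsumZr l tS).
rewrite [X in X @ _ --> _](_ : _ = fun K => summability.sum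
    (fun j => t ^+ j / j`!%:R * P (K - j)%N)); last first.
  apply/funext => K; rewrite (fsum_finite_support (K := K)) // => j Kj.
  by rewrite (eqP Kj) P0 mulr0.
apply: (tannery (B := B)) => // j.
apply: (@cvg_infty_comp _ _ _ (fun n => n - j)%N (addn j)) => // N n.
by move=> /(leq_sub2r j); rewrite addKn.
Qed.

(** Zeros inserted between the terms only repeat partial sums. *)
Lemma spread_series_cvg (L : nat -> C) (p : nat) (l : C) :
  (0 < p)%N -> series L @ \oo --> l ->
  (fun K => \sum_(q < K) if (p %| q)%N then L (q %/ p)%N else 0) @ \oo --> l.
Proof.
move=> p0 Ll; rewrite -cvg_shiftS /=.
have -> : (fun K => \sum_(q < K.+1) if (p %| q)%N then L (q %/ p)%N else 0)
    = (fun n => series L (n %/ p).+1).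
  apply/funext => n; rewrite seriesEord /=.
  by have := sum_multiples L (fun=> 1) n p0; rewrite /= -!mulr_suml !mulr1.
apply: (@cvg_infty_comp _ _ _ (fun n => (n %/ p).+1) (fun N => N * p)%N) =>
  // N n.
by rewrite -leq_divRL // => /leqW.
Qed.

End Generating_function.

(** * The generating function *)

Theorem theorem8 (R : realType) (r k rho s : nat)
  (beta gamma x : 'I_r -> R[i]) (y : 'I_s -> R[i])
  (Omega : R[i] -> ('I_s -> R[i]) -> R[i]) (mu psi : R[i]) (a : nat -> R[i])
  (p : nat) (eta t : R[i])
  (r_gt0 : (0 < r)%N) (k_le_r : (k <= r)%N) (s_gt0 : (0 < s)%N)
  (p_gt0 : (0 < p)%N)
  (gammaP : forall (i : 'I_r) (n : nat), gamma i != - n%:R)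
  (xP : E_domain k rho x)
  (OmegaP : forall nu : R[i], exists z : 'I_s -> R[i], Omega nu z != 0)
  (aP : forall l : nat, a l != 0)
  (t_neq0 : t != 0) (t_lt1 : `|t| < 1)
  (lhs_cvg : cvgn (series (fun n : nat =>
     Theta a Omega mu psi k rho beta gamma n p x y (eta / t ^+ p) * t ^+ n)))
  (Lambda_cvg : cvgn (series (Lambda_term a Omega mu psi y eta))) :
  limn (series (fun n : nat =>
     Theta a Omega mu psi k rho beta gamma n p x y (eta / t ^+ p) * t ^+ n))
  = Lambda a Omega mu psi y eta * cexp t
    * (\prod_(i < r | (i < k)%N) hyp0F1 (gamma i) (x i * (- t) ^+ rho))
    * (\prod_(i < r | (k <= i)%N) hyp1F1 (beta i) (gamma i) (- (x i * t))).
Proof.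
set L := Lambda_term a Omega mu psi y eta.
pose lam q := if (p %| q)%N then L (q %/ p)%N else 0.
pose P K := \sum_(q < K) lam q.
pose D (m : {ffun 'I_r -> nat}) :=
  \prod_i factor_term k rho beta gamma x t i (m i).
pose W K := \sum_(j < K) t ^+ j / j`!%:R * P (K - j)%N.
have DS : abs_summable D
  by exact: abs_summable_prod (factor_term_summable _ _ _ _ _ _).
have [B tB] := exp_coeff_shift_bounded t.
(* Partial sums of the left-hand side as sums over multi-indices. *)
have LhsE J : \sum_(n < J)
    Theta a Omega mu psi k rho beta gamma n p x y (eta / t ^+ p) * t ^+ n
    = summability.sum (fun m => D m * W (J - pochhammer_index k rho m)%N).
  pose G N := t ^+ N / N`!%:R * E_fun k rho (- N%:R) beta gamma x.
  (* The powers t^(p l) cancel against the argument eta / t^p. *)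
  transitivity (\sum_(n < J) \sum_(q < n.+1) lam q * G (n - q)%N).
    apply: eq_bigr => n _; rewrite sum_multiples // /Theta mulr_suml.
    apply: eq_bigr => l _; rewrite /G /L /Lambda_term.
    have pl_n : (p * l <= n)%N.
      by rewrite mulnC -leq_divRL //; exact: (ltn_ord l).
    have -> : t ^+ n = t ^+ (n - p * l) * t ^+ (p * l) by rewrite -exprD subnK.
    rewrite exprMn exprVn -exprM.
    have tpl0 : t ^+ (p * l) != 0 by rewrite expf_neq0.
    have fact0 : (n - p * l)`!%:R != 0 :> R[i].
      by rewrite pnatr_eq0 -lt0n fact_gt0.
    by field; rewrite tpl0 fact0.
  rewrite sum_convolution.
  transitivity (\sum_(N < J) P (J - N)%N * summability.sum
      (fun m => D m * exp_coeff_shift t (pochhammer_index k rho m) N)).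
    by apply: eq_bigr => N _; rewrite mulrC /G E_fun_opp_nat.
  rewrite fsum_linear => [|N]; last first.
    by apply: abs_summableM DS _ => m; exact: tB.
  congr summability.sum; apply/funext => m.
  rewrite /W -sum_exp_coeff_shift mulr_sumr.
  by apply: eq_bigr => N _; rewrite mulrCA [P _ * _]mulrC.
have L_cvg : series L @ \oo --> Lambda a Omega mu psi y eta by [].
have P_cvg : P @ \oo --> Lambda a Omega mu psi y eta.
  exact: spread_series_cvg.
have W_cvg : W @ \oo --> cexp t * Lambda a Omega mu psi y eta.
  by apply: mertens_exp P_cvg; rewrite /P big_ord0.
have [BW WB] := cvg_bounded W_cvg.
have Lhs_cvg : series (fun n : nat =>
     Theta a Omega mu psi k rho beta gamma n p x y (eta / t ^+ p) * t ^+ n)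
     @ \oo --> summability.sum D * (cexp t * Lambda a Omega mu psi y eta).
  rewrite -(fsumZr _ DS) [X in X @ _ --> _](_ : _ = fun J =>
    summability.sum (fun m => D m * W (J - pochhammer_index k rho m)%N));
    last first.
    by apply/funext => J; rewrite -LhsE seriesEord.
  apply: (@tannery _ _ D (fun J m => W (J - pochhammer_index k rho m)%N)
    (fun=> _) BW DS)
    => [J m|m]; first exact: WB.
  apply: (@cvg_infty_comp _ _ _ (fun n => n - pochhammer_index k rho m)%N
    (addn (pochhammer_index k rho m))) W_cvg => N n.
  by move=> /(leq_sub2r (pochhammer_index k rho m)); rewrite addKn.
rewrite (cvg_lim _ Lhs_cvg); last exact: norm_hausdorff.
rewrite fsum_prod; last exact: factor_term_summable.
rewrite mulrC [cexp t * _]mulrC -[RHS]mulrA; congr (_ * _).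
rewrite (bigID (fun i : 'I_r => i < k)%N) /=; congr (_ * _).
  apply: eq_bigr => i ik; rewrite /hyp0F1 limn_fsum;
    last exact: abs_summable_0F1.
  by congr summability.sum; apply/funext => j; rewrite /factor_term ik.
apply: eq_big => i; first by rewrite -leqNgt.
move=> /negPf ik; rewrite /hyp1F1 limn_fsum;
    last exact: abs_summable_1F1.
by congr summability.sum; apply/funext => j; rewrite /factor_term ik.
Qed.
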